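(* Let $A\in\mathbb{H}^{n\times n}$. Then $$r(A)=\min\Big\{a\in\mathbb{R}:\ \text{there is } Z\in\mathbb{H}^{n\times n}\text{ with } \begin{bmatrix}aI_n+Z&A\\ A^*&aI_n-Z\end{bmatrix}\in\mathrm{H}_{2n,+}(\mathbb{H})\Big\}.$$
   Context: $\mathbb{H}$ is the skew-field of quaternions with modulus $|q|$; $A^*$ is the conjugate transpose of a quaternionic matrix. $\mathrm{H}_{N,+}(\mathbb{H})$ is the cone of positive semidefinite matrices in $\mathbb{H}^{N\times N}$: those $M$ with $M^*=M$ and $\mathbf{x}^*M\mathbf{x}\ge0$ for all $\mathbf{x}\in\mathbb{H}^N$ (so any feasible $Z$ is selfadjoint). The numerical radius of $A\in\mathbb{H}^{n\times n}$ is $r(A)=\max\{|\mathbf{x}^*A\mathbf{x}|:\mathbf{x}\in\mathbb{H}^n,\ \mathbf{x}^*\mathbf{x}=1\}$. *)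

(* Defs.v *)
From HB Require Import structures.
From mathcomp Require Import all_boot all_order all_algebra.
From mathcomp Require Import ring lra.
From mathcomp Require Import all_classical all_reals all_analysis.
Set Implicit Arguments. Unset Strict Implicit. Unset Printing Implicit Defensive.
Import Order.TTheory GRing.Theory Num.Theory.
Import numFieldNormedType.Exports.
Local Open Scope classical_set_scope.
Local Open Scope ring_scope.

(* [Quat a b c d] is a + b i + c j + d k. *)
Record quat (R : Type) := Quat { q0 : R; q1 : R; q2 : R; q3 : R }.

Definition quat_to_prod R (x : quat R) : R * R * R * R :=
  (q0 x, q1 x, q2 x, q3 x).
Definition quat_of_prod R (x : R * R * R * R) : quat R :=
  Quat x.1.1.1 x.1.1.2 x.1.2 x.2.
Lemma quat_to_prodK R : cancel (@quat_to_prod R) (@quat_of_prod R).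
Proof. by case. Qed.

HB.instance Definition _ (R : choiceType) :=
  Choice.copy (quat R) (can_type (@quat_to_prodK R)).

Section QuatRing.
Variable R : comNzRingType.
Implicit Types x y z : quat R.

Definition addq x y :=
  Quat (q0 x + q0 y) (q1 x + q1 y) (q2 x + q2 y) (q3 x + q3 y).
Definition oppq x := Quat (- q0 x) (- q1 x) (- q2 x) (- q3 x).
Definition realq (a : R) : quat R := Quat a 0 0 0.
Definition mulq x y := Quat
  (q0 x * q0 y - q1 x * q1 y - q2 x * q2 y - q3 x * q3 y)
  (q0 x * q1 y + q1 x * q0 y + q2 x * q3 y - q3 x * q2 y)
  (q0 x * q2 y - q1 x * q3 y + q2 x * q0 y + q3 x * q1 y)
  (q0 x * q3 y + q1 x * q2 y - q2 x * q1 y + q3 x * q0 y).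

Lemma addqA : associative addq.
Proof. by move=> x y z; rewrite /addq /=; congr Quat; ring. Qed.
Lemma addqC : commutative addq.
Proof. by move=> x y; rewrite /addq /=; congr Quat; ring. Qed.
Lemma add0q : left_id (realq 0) addq.
Proof. by case=> a b c d; rewrite /addq /=; congr Quat; ring. Qed.
Lemma addNq : left_inverse (realq 0) oppq addq.
Proof. by move=> x; rewrite /addq /realq /=; congr Quat; ring. Qed.

HB.instance Definition _ :=
  GRing.isZmodule.Build (quat R) addqA addqC add0q addNq.

Lemma mulqA : associative mulq.
Proof. by move=> x y z; rewrite /mulq /=; congr Quat; ring. Qed.
Lemma mul1q : left_id (realq 1) mulq.
Proof. by case=> a b c d; rewrite /mulq /=; congr Quat; ring. Qed.
Lemma mulq1 : right_id (realq 1) mulq.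
Proof. by case=> a b c d; rewrite /mulq /=; congr Quat; ring. Qed.
Lemma mulqDl : left_distributive mulq addq.
Proof. by move=> x y z; rewrite /mulq /addq /=; congr Quat; ring. Qed.
Lemma mulqDr : right_distributive mulq addq.
Proof. by move=> x y z; rewrite /mulq /addq /=; congr Quat; ring. Qed.
Lemma oneq_neq0 : realq 1 != 0 :> quat R.
Proof. by apply/eqP => -[] /eqP; rewrite oner_eq0. Qed.

HB.instance Definition _ :=
  GRing.Zmodule_isNzRing.Build (quat R)
    mulqA mul1q mulq1 mulqDl mulqDr oneq_neq0.

Definition conjq x : quat R := Quat (q0 x) (- q1 x) (- q2 x) (- q3 x).

Definition adjmx m n (A : 'M[quat R]_(m, n)) : 'M[quat R]_(n, m) :=
  (map_mx conjq A)^T.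

Lemma adjmxE m n (A : 'M[quat R]_(m, n)) i j :
  adjmx A i j = conjq (A j i).
Proof. by rewrite !mxE. Qed.

End QuatRing.

Notation "A ^H" := (adjmx A) (at level 1, format "A ^H") : ring_scope.

Definition normq (R : rcfType) (x : quat R) : R :=
  Num.sqrt (q0 x ^+ 2 + q1 x ^+ 2 + q2 x ^+ 2 + q3 x ^+ 2).

(* The value of a 1 x 1 product [x^H *m M *m x] is its entry [0 0];
   being >= 0 means being a nonnegative real. *)
Definition psdmx (R : rcfType) N (M : 'M[quat R]_N) : Prop :=
  M^H = M /\
  forall x : 'cV[quat R]_N,
    exists2 r : R, 0 <= r & (x^H *m M *m x) 0 0 = realq r.

Definition qf_moduli (R : rcfType) n (A : 'M[quat R]_n) : set R :=
  [set normq ((x^H *m A *m x) 0 0) | x in [set x : 'cV[quat R]_n | x^H *m x = 1%:M]].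

(* The supremum is attained when 0 < n, see [numerical_radius_max]. *)
Definition numerical_radius (R : realType) n (A : 'M[quat R]_n) : R :=
  sup (qf_moduli A).

Definition is_max (R : numDomainType) (E : set R) (m : R) : Prop :=
  E m /\ ubound E m.
Definition is_min (R : numDomainType) (E : set R) (m : R) : Prop :=
  E m /\ lbound E m.

Section Attained.
Variable R : realType.

Local Definition qcont (T : topologicalType) (f : T -> quat R) :=
  [/\ continuous (fun t => q0 (f t)), continuous (fun t => q1 (f t)),
      continuous (fun t => q2 (f t)) & continuous (fun t => q3 (f t))].

Local Ltac cont := repeat first
  [ match goal with H : continuous _ |- _ => exact: H end
  | exact: cvg_cst | apply: cvgD | apply: cvgN | apply: cvgM ].

Local Lemma qcontD (T : topologicalType) (f g : T -> quat R) :
  qcont f -> qcont g -> qcont (fun t => f t + g t).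
Proof. by move=> [? ? ? ?] [? ? ? ?]; split=> /= t; cont. Qed.

Local Lemma qcontM (T : topologicalType) (f g : T -> quat R) :
  qcont f -> qcont g -> qcont (fun t => f t * g t).
Proof. by move=> [? ? ? ?] [? ? ? ?]; split=> /= t; cont. Qed.

Local Lemma qcontJ (T : topologicalType) (f : T -> quat R) :
  qcont f -> qcont (fun t => conjq (f t)).
Proof. by move=> [? ? ? ?]; split=> /= t; cont. Qed.

Local Lemma qcont_cst (T : topologicalType) (c : quat R) : qcont (fun _ : T => c).
Proof. by split=> /= t; cont. Qed.

Local Lemma qcont_sum (T : topologicalType) (I : finType) (f : I -> T -> quat R) :
  (forall i, qcont (f i)) -> qcont (fun t => \sum_i f i t).
Proof.
move=> cf; elim: (index_enum I) => [|i s IHs].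
  by under eq_fun do rewrite big_nil; exact: qcont_cst.
by under eq_fun do rewrite big_cons; exact: qcontD.
Qed.

Local Definition dec n (v : 'rV[R]_(n * 4)) : 'cV[quat R]_n :=
  \col_i Quat (v 0 (mxvec_index i 0)) (v 0 (mxvec_index i 1))
              (v 0 (mxvec_index i 2%:R)) (v 0 (mxvec_index i 3%:R)).

Local Definition enc n (x : 'cV[quat R]_n) : 'rV[R]_(n * 4) :=
  mxvec (\matrix_(i, j) nth 0 [:: q0 (x i 0); q1 (x i 0);
                                  q2 (x i 0); q3 (x i 0)] j).

Local Lemma encK n : cancel (@enc n) (@dec n).
Proof.
move=> x; apply/colP => i; rewrite !mxE !mxvecE !mxE /=.
by case: (x i 0).
Qed.

Local Lemma qcont_dec n i : qcont (fun v : 'rV[R]_(n * 4) => dec v i 0).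
Proof.
by split; (under eq_fun do rewrite mxE /=); exact: coord_continuous.
Qed.

Local Lemma qcont_mx (T : topologicalType) m n p
    (f : T -> 'M[quat R]_(m, n)) (g : T -> 'M[quat R]_(n, p)) :
  (forall i j, qcont (fun t => f t i j)) ->
  (forall i j, qcont (fun t => g t i j)) ->
  forall i j, qcont (fun t => (f t *m g t) i j).
Proof.
move=> cf cg i j; under eq_fun do rewrite mxE.
by apply: qcont_sum => k; exact: qcontM.
Qed.

Lemma q0_sum (I : finType) (f : I -> quat R) :
  q0 (\sum_i f i) = \sum_i q0 (f i).
Proof. by apply: (big_morph (@q0 R)). Qed.


Lemma numerical_radius_max n (A : 'M[quat R]_n) :
  (0 < n)%N -> is_max (qf_moduli A) (numerical_radius A).
Proof.
move=> n0.
pose S := [set v : 'rV[R]_(n * 4) | (dec v)^H *m dec v = 1%:M].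
pose f (v : 'rV[R]_(n * 4)) := normq (((dec v)^H *m A *m dec v) 0 0).
have cdec i j : qcont (fun v : 'rV[R]_(n * 4) => dec v i j).
  by rewrite (ord1 j); exact: qcont_dec.
have cdecJ i j : qcont (fun v : 'rV[R]_(n * 4) => (dec v)^H i j).
  by under eq_fun do rewrite adjmxE; exact: qcontJ.
have cS : closed S.
  have [c0 c1 c2 c3] := qcont_mx cdecJ cdec 0 0.
  have -> : S = (fun v => q0 (((dec v)^H *m dec v) 0 0)) @^-1` [set 1]
    `&` (fun v => q1 (((dec v)^H *m dec v) 0 0)) @^-1` [set 0]
    `&` (fun v => q2 (((dec v)^H *m dec v) 0 0)) @^-1` [set 0]
    `&` (fun v => q3 (((dec v)^H *m dec v) 0 0)) @^-1` [set 0].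
    apply/seteqP; split=> v /=.
      by rewrite /S /= => ->; rewrite mxE eqxx.
    move=> [[[e0 e1] e2] e3]; rewrite /S /=.
    apply/matrixP => i j; rewrite !ord1 [RHS]mxE eqxx.
    by move: e0 e1 e2 e3; case: (_ 0 0) => /= ? ? ? ? -> -> -> ->.
  by do 3?apply: closedI; apply: closed_comp => //; try exact: closed_eq.
have bS v : S v -> forall k, v 0 k \in `[(-1 : R), 1].
  move=> /(congr1 (fun M : 'M[quat R]_1 => q0 (M 0 0))).
  rewrite [X in q0 X = _]mxE [X in _ = q0 X]mxE eqxx /= q0_sum => sv k.
  case/mxvec_indexP: k => i j.
  have nn l : 0 <= q0 ((dec v)^H 0 l * dec v l 0).
    rewrite !mxE /= !mulNr !opprK.
    by rewrite !addr_ge0 // -expr2 sqr_ge0.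
  have : q0 ((dec v)^H 0 i * dec v i 0) <= 1.
    by rewrite -[leRHS]sv (bigD1 i) //= lerDl; apply: sumr_ge0 => l _; exact: nn.
  rewrite !mxE /= !mulNr !opprK -!expr2 => le1.
  have : v 0 (mxvec_index i j) ^+ 2 <= 1.
    apply: le_trans le1.
    have p (k : 'I_4) := sqr_ge0 (v 0 (mxvec_index i k)).
    have le4 (a b c d : R) : 0 <= a -> 0 <= b -> 0 <= c -> 0 <= d ->
        [/\ a <= a + b + c + d, b <= a + b + c + d,
            c <= a + b + c + d & d <= a + b + c + d].
      by move=> *; split; lra.
    have [l0 l1 l2 l3] := le4 _ _ _ _ (p 0) (p 1) (p 2%:R) (p 3%:R).
    have : [\/ j = 0, j = 1, j = 2%:R | j = 3%:R].
      by case: j => -[|[|[|[|//]]]] lt4; [constructor 1|constructor 2|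
         constructor 3|constructor 4]; apply: val_inj.
    by case=> ->; [exact: l0|exact: l1|exact: l2|exact: l3].
  by rewrite in_itv /= -ler_norml -real_normK ?num_real // expr_le1.
have kS : compact S.
  apply: (subclosed_compact cS
    (@rV_compact _ _ (fun=> `[(-1 : R), 1]%classic) (fun=> @segment_compact _ _ _))).
  by move=> v /bS Sv k; exact: Sv.
have S0 : S !=set0.
  exists (enc (delta_mx (Ordinal n0) 0)); rewrite /S /= encK.
  apply/matrixP => i j; rewrite !ord1 !mxE (bigD1 (Ordinal n0)) //= big1 ?addr0.
    rewrite !mxE !eqxx /=; congr Quat; rewrite /=; ring.
  by move=> k /negbTE kn; rewrite !mxE kn /= mulr0.
have cf : continuous f.
  have cA i j : qcont (fun _ : 'rV[R]_(n * 4) => A i j) by exact: qcont_cst.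
  have [c0 c1 c2 c3] := qcont_mx (qcont_mx cdecJ cA) cdec 0 0.
  move=> v; rewrite /f /normq.
  apply: continuous_comp; last exact: sqrt_continuous.
  have c_sqr (g : 'rV[R]_(n * 4) -> R) :
      continuous g -> (fun v => g v ^+ 2) @ v --> g v ^+ 2.
    by move=> cg; exact: (cvgM (cg v) (cg v)).
  exact: (cvgD (cvgD (cvgD (c_sqr _ c0) (c_sqr _ c1)) (c_sqr _ c2))
               (c_sqr _ c3)).
have [c cS' maxc] := compact_EVT_max S0 kS (continuous_subspaceT cf).
rewrite inE in cS'.
have mE : is_max (qf_moduli A) (f c).
  split; first by exists (dec c).
  move=> _ [x x1 <-]; rewrite -[x]encK; apply: maxc.
  by rewrite inE /S /= encK.
suff -> : numerical_radius A = f c by [].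
case: mE => Ec uc; apply/eqP; rewrite eq_le; apply/andP; split.
  by apply: ge_sup => //; exists (f c).
by apply: ub_le_sup => //; exists (f c).
Qed.
End Attained.

(* Main.v *)
From HB Require Import structures.
Require Import Defs.
From mathcomp Require Import all_boot all_order all_algebra.
From mathcomp Require Import ring lra.
From mathcomp Require Import all_classical all_reals.
From mathcomp Require Import trigo.
Import Defs.
Import Order.TTheory GRing.Theory Num.Theory.
Local Open Scope classical_set_scope.
Local Open Scope ring_scope.
Set Implicit Arguments.
Unset Strict Implicit.
Unset Printing Implicit Defensive.

(** Let [r] be the numerical radius of [A].

    If [a] is feasible with [Z], apply the block matrix to the vector
    [(x, x s)] with [x^* x = 1] and [s] a unit quaternion. The contributions of
    [Z] cancel in the real part, which leaves [2 a + 2 Re (x^* A x s) >= 0];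
    choosing [s] opposite to the conjugate of [x^* A x] gives [|x^* A x| <= a].

    Conversely a matrix [Z] feasible for [a = r] has to be produced. To a
    finitely supported sequence [u_0, u_1, ...] of columns attach the energy
    [sum_k (r |u_k|^2 + Re (u_k^* A u_(k+1)))]. It is nonnegative
    ([energy_ge0]): with [e] the exponential with values in the subfield
    [R + R i], the energy is the average, over the angles [t] of a cyclic group
    of roots of unity, of [r |f|^2 + Re (f^* A f e(-t))], where
    [f = sum_k u_k e(k t)] is formed with scalars on the right; each of these
    terms is nonnegative because [|f^* A f| <= r |f|^2].

    Let [phi x] be the infimum of the energies of the sequences starting at
    [x]. Prepending [x] to a sequence starting at [y] shows
    [phi x <= r |x|^2 + Re (x^* A y) + phi y] ([least_energy_shift]). An infimum
    of quadratic forms over sequences subject to a linear condition is again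
    quadratic: [phi] satisfies the parallelogram law and
    [phi (x q) = |q|^2 phi x]. By a Jordan-von Neumann argument
    ([selfadjoint_of_quadratic]) [phi x = Re (x^* H x)] for a selfadjoint [H],
    and with [Z = r I - 2 H] twice the displayed inequality is the positivity of
    the block matrix. *)

(** * Quaternions *)

Section QuaternionAlgebra.
Variable R : comNzRingType.
Implicit Types (p q : quat R) (a : R).

Lemma conjqD p q : conjq (p + q) = conjq p + conjq q.
Proof. by congr Quat; rewrite /= ?opprD. Qed.

Lemma conjqM p q : conjq (p * q) = conjq q * conjq p.
Proof. by congr Quat; rewrite /=; ring. Qed.

Lemma conjqK : involutive (@conjq R).
Proof. by case=> a b c d; rewrite /conjq /= !opprK. Qed.

Lemma conjq_realq a : conjq (realq a) = realq a.
Proof. by rewrite /conjq /= !oppr0. Qed.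

Lemma conjq_sum (I : finType) (f : I -> quat R) :
  conjq (\sum_i f i) = \sum_i conjq (f i).
Proof. exact: (big_morph _ conjqD (conjq_realq 0)). Qed.

Lemma q0_conjqM p q : q0 (conjq p * q) = q0 (p * conjq q).
Proof. by rewrite /=; ring. Qed.

Lemma q0_mulC p q : q0 (p * q) = q0 (q * p).
Proof. by rewrite /=; ring. Qed.

Lemma realqC a p : realq a * p = p * realq a.
Proof. by congr Quat; rewrite /=; ring. Qed.

Definition sqnormq p := q0 p ^+ 2 + q1 p ^+ 2 + q2 p ^+ 2 + q3 p ^+ 2.

Lemma sqnormq_realq a : sqnormq (realq a) = a ^+ 2.
Proof. by rewrite /sqnormq /= expr0n /= !addr0. Qed.

Lemma sqnormqM p q : sqnormq (p * q) = sqnormq p * sqnormq q.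
Proof. by rewrite /sqnormq /=; ring. Qed.

Lemma mulq_conjq p : p * conjq p = realq (sqnormq p).
Proof. by congr Quat; rewrite /= /sqnormq; ring. Qed.

Lemma conjq_mulq p : conjq p * p = realq (sqnormq p).
Proof. by congr Quat; rewrite /= /sqnormq; ring. Qed.

(** The four units, used as [s], read off the coordinates up to sign. *)
Lemma q0_mul_inj p q : (forall s, q0 (p * s) = q0 (q * s)) -> p = q.
Proof.
move=> H; case: p q H => [a b c d] [a' b' c' d'] H.
move: (H (Quat 1 0 0 0)) (H (Quat 0 (-1) 0 0)) (H (Quat 0 0 (-1) 0))
  (H (Quat 0 0 0 (-1))); rewrite /= !mulr0 !mulr1 !mulrN1 !subr0 !sub0r !opprK.
by rewrite ?addr0 ?add0r => -> -> -> ->.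
Qed.

End QuaternionAlgebra.

Section QuaternionInverse.
Variable R : realFieldType.
Implicit Types (p q : quat R) (a : R).

Lemma sqnormq_ge0 p : 0 <= sqnormq p.
Proof. by rewrite /sqnormq !addr_ge0 // sqr_ge0. Qed.

Lemma sqnormq_eq0 p : (sqnormq p == 0) = (p == 0).
Proof.
apply/eqP/eqP => [|->]; last by rewrite (sqnormq_realq 0) expr0n.
case: p => a b c d; rewrite /sqnormq /= => h.
have [ha hb hc hd] : [/\ 0 <= a ^+ 2, 0 <= b ^+ 2, 0 <= c ^+ 2 & 0 <= d ^+ 2].
  by split; exact: sqr_ge0.
by congr Quat; apply/eqP; rewrite -sqrf_eq0; apply/eqP; lra.
Qed.

Lemma conjq_fixed p : conjq p = p -> p = realq (q0 p).
Proof. by case: p => a b c d [hb hc hd]; congr Quat; rewrite /=; lra. Qed.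

Definition invq p : quat R := conjq p * realq (sqnormq p)^-1.

Lemma mulqV p : p != 0 -> p * invq p = 1.
Proof.
rewrite -sqnormq_eq0 => p0.
by rewrite /invq mulrA mulq_conjq; congr Quat; rewrite /=; field.
Qed.

Lemma mulVq p : p != 0 -> invq p * p = 1.
Proof.
rewrite -sqnormq_eq0 => p0; rewrite /invq -mulrA realqC mulrA conjq_mulq.
by congr Quat; rewrite /=; field.
Qed.

End QuaternionInverse.

Section QuaternionModulus.
Variable R : rcfType.
Implicit Types (p q : quat R) (a : R).

Lemma normqE p : normq p = Num.sqrt (sqnormq p).
Proof. by []. Qed.

Lemma sqr_normq p : normq p ^+ 2 = sqnormq p.
Proof. by rewrite normqE sqr_sqrtr // sqnormq_ge0. Qed.

Lemma normqM p q : normq (p * q) = normq p * normq q.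
Proof. by rewrite !normqE sqnormqM sqrtrM // sqnormq_ge0. Qed.

Lemma normq_realq a : 0 <= a -> normq (realq a) = a.
Proof.
move=> a0; rewrite normqE sqnormq_realq sqrtr_sqr.
exact: ger0_norm.
Qed.

Lemma q0_ge_Nnormq p : - normq p <= q0 p.
Proof.
rewrite lerNl; apply: le_trans (ler_norm _) _; rewrite normrN -sqrtr_sqr.
by rewrite ler_wsqrtr // -!addrA lerDl !addr_ge0 // sqr_ge0.
Qed.

(** Take [s = - p^* / |p|], or any unit when [p = 0]. *)
Lemma exists_unit_opposite p :
  exists2 s : quat R, sqnormq s = 1 & q0 (p * s) = - normq p.
Proof.
have [->|p0] := eqVneq p 0.
  exists 1; first by rewrite (sqnormq_realq 1) expr1n.
  by rewrite mul0r (normq_realq (lexx 0)) oppr0.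
have n0 : normq p != 0.
  by rewrite -sqrf_eq0 sqr_normq sqnormq_eq0.
exists (conjq p * realq (- (normq p)^-1)).
  have -> : sqnormq (conjq p * realq (- (normq p)^-1)) =
      sqnormq p * ((normq p)^-1) ^+ 2 by rewrite sqnormqM /sqnormq /=; ring.
  by rewrite -sqr_normq -exprMn divff // expr1n.
rewrite mulrA mulq_conjq -sqr_normq /=; field.
exact: n0.
Qed.

End QuaternionModulus.

(** * Quaternionic sesquilinear forms *)

Section Adjoint.
Variable R : comNzRingType.

Lemma adjmxM m n p (A : 'M[quat R]_(m, n)) (B : 'M[quat R]_(n, p)) :
  (A *m B)^H = B^H *m A^H.
Proof.
apply/matrixP => i j; rewrite adjmxE !mxE conjq_sum; apply: eq_bigr => k _.
by rewrite !adjmxE conjqM.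
Qed.

Lemma adjmxK m n (A : 'M[quat R]_(m, n)) : A^H^H = A.
Proof. by apply/matrixP => i j; rewrite !adjmxE conjqK. Qed.

Lemma adjmxD m n (A B : 'M[quat R]_(m, n)) : (A + B)^H = A^H + B^H.
Proof. by apply/matrixP => i j; rewrite !mxE conjqD. Qed.

Lemma adjmxN m n (A : 'M[quat R]_(m, n)) : (- A)^H = - A^H.
Proof. by apply/matrixP => i j; rewrite !mxE. Qed.

Lemma adjmx_scalar n q : (q%:M : 'M[quat R]_n)^H = (conjq q)%:M.
Proof.
apply/matrixP => i j; rewrite adjmxE !mxE eq_sym.
by case: eqP; rewrite ?mulr1n // !mulr0n conjq_realq.
Qed.

Lemma adjmx_col m1 m2 n (A : 'M[quat R]_(m1, n)) (B : 'M[quat R]_(m2, n)) :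
  (col_mx A B)^H = row_mx A^H B^H.
Proof. by rewrite /adjmx map_col_mx tr_col_mx. Qed.

Lemma adjmx_block m1 m2 n1 n2 (Aul : 'M[quat R]_(m1, n1)) Aur Adl
    (Adr : 'M[quat R]_(m2, n2)) :
  (block_mx Aul Aur Adl Adr)^H = block_mx Aul^H Adl^H Aur^H Adr^H.
Proof. by rewrite /adjmx map_block_mx tr_block_mx. Qed.

End Adjoint.

(** Columns form a right vector space over the quaternions; the library's
    scaling of matrices is on the left, hence this separate operation. *)
HB.lock Definition rscale (R : comNzRingType) n (x : 'cV[quat R]_n) (q : quat R) :
  'cV[quat R]_n := x *m q%:M.
Canonical rscale_unlockable := Unlockable rscale.unlock.

Notation "x *> q" := (rscale x q) (at level 40) : ring_scope.

(** The real part of [x^* A y] is what survives of the sesquilinear form once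
    the noncommutativity of the scalars is disposed of: since the real part of
    a product does not depend on the order of its factors, a scalar can be
    moved from one argument to the other. *)
HB.lock Definition rform (R : comNzRingType) m n (A : 'M[quat R]_(m, n))
  (x : 'cV[quat R]_m) (y : 'cV[quat R]_n) : R := q0 ((x^H *m A *m y) 0 0).
Canonical rform_unlockable := Unlockable rform.unlock.

Section RealForm.
Variable R : comNzRingType.
Implicit Types (q s : quat R) (a : R).

Lemma rscaleE n (x : 'cV[quat R]_n) q i : (x *> q) i 0 = x i 0 * q.
Proof. by rewrite unlock mxE big_ord1 !mxE eqxx mulr1n. Qed.

Lemma rscaleDl n (x y : 'cV[quat R]_n) q : (x + y) *> q = x *> q + y *> q.
Proof. rewrite !unlock; exact: mulmxDl. Qed.

Lemma rscaleBl n (x y : 'cV[quat R]_n) q : (x - y) *> q = x *> q - y *> q.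
Proof. rewrite !unlock; exact: mulmxBl. Qed.

Lemma rscaleDr n (x : 'cV[quat R]_n) q s : x *> (q + s) = x *> q + x *> s.
Proof. by apply/colP => i; rewrite [RHS]mxE !rscaleE mulrDr. Qed.

Lemma rscaleNr n (x : 'cV[quat R]_n) q : x *> (- q) = - (x *> q).
Proof. by apply/colP => i; rewrite [RHS]mxE !rscaleE mulrN. Qed.

Lemma rscale0r n (x : 'cV[quat R]_n) : x *> 0 = 0.
Proof. by apply/colP => i; rewrite rscaleE mulr0 [RHS]mxE. Qed.

Lemma rscale0l n q : (0 : 'cV[quat R]_n) *> q = 0.
Proof. rewrite unlock; exact: mul0mx. Qed.

Lemma rscale1 n (x : 'cV[quat R]_n) : x *> 1 = x.
Proof. rewrite !unlock; exact: mulmx1. Qed.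

Lemma rscaleA n (x : 'cV[quat R]_n) q s : x *> q *> s = x *> (q * s).
Proof. by apply/colP => i; rewrite !rscaleE mulrA. Qed.

Lemma rscale_sumr n (x : 'cV[quat R]_n) (I : Type) (r : seq I) (f : I -> quat R) :
  x *> (\sum_(i <- r) f i) = \sum_(i <- r) x *> f i.
Proof. exact: (big_morph _ (rscaleDr x) (rscale0r x)). Qed.

Lemma rscale_suml n (q : quat R) (I : Type) (r : seq I) (f : I -> 'cV[quat R]_n) :
  (\sum_(i <- r) f i) *> q = \sum_(i <- r) f i *> q.
Proof.
exact: (big_morph _ (fun x y => rscaleDl x y q) (rscale0l n q)).
Qed.

Section Forms.
Variables (m n : nat) (A : 'M[quat R]_(m, n)).
Implicit Types (x : 'cV[quat R]_m) (y : 'cV[quat R]_n).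

Lemma rformDl x x' y : rform A (x + x') y = rform A x y + rform A x' y.
Proof. by rewrite unlock adjmxD !mulmxDl mxE. Qed.

Lemma rformDr x y y' : rform A x (y + y') = rform A x y + rform A x y'.
Proof. by rewrite unlock mulmxDr mxE. Qed.

Lemma rformNl x y : rform A (- x) y = - rform A x y.
Proof. by rewrite unlock adjmxN !mulNmx mxE. Qed.

Lemma rformNr x y : rform A x (- y) = - rform A x y.
Proof. by rewrite unlock mulmxN mxE. Qed.

Lemma rform0l y : rform A 0 y = 0.
Proof. by apply: (addrI (rform A 0 y)); rewrite -rformDl !addr0. Qed.

Lemma rform0r x : rform A x 0 = 0.
Proof. by rewrite unlock mulmx0 mxE. Qed.

Lemma rform_suml (I : Type) (r : seq I) (f : I -> 'cV[quat R]_m) y :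
  rform A (\sum_(i <- r) f i) y = \sum_(i <- r) rform A (f i) y.
Proof.
exact: (big_morph (fun x => rform A x y) (fun x x' => rformDl x x' y) (rform0l y)).
Qed.

Lemma rform_sumr (I : Type) (r : seq I) x (f : I -> 'cV[quat R]_n) :
  rform A x (\sum_(i <- r) f i) = \sum_(i <- r) rform A x (f i).
Proof. exact: (big_morph (rform A x) (rformDr x) (rform0r x)). Qed.

Lemma rform_scalerE x y q :
  rform A x (y *> q) = q0 ((x^H *m A *m y) 0 0 * q).
Proof. by rewrite -rscaleE !unlock !mulmxA. Qed.

Lemma rform_realq x y a : rform A x (y *> realq a) = a * rform A x y.
Proof. by rewrite rform_scalerE unlock /=; ring. Qed.

Lemma rform_scalel x y q : rform A (x *> q) y = rform A x (y *> conjq q).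
Proof.
rewrite rform_scalerE q0_mulC !unlock adjmxM adjmx_scalar -!mulmxA.
by rewrite mxE big_ord1 mxE eqxx mulr1n.
Qed.

Lemma rform_adj x y : rform A^H y x = rform A x y.
Proof.
rewrite unlock -[RHS]/(q0 (conjq _)) -adjmxE !adjmxM adjmxK mulmxA.
by [].
Qed.

End Forms.

Lemma rform_scale n (A : 'M[quat R]_n) x y q :
  rform A (x *> q) (y *> q) = sqnormq q * rform A x y.
Proof. by rewrite rform_scalel rscaleA mulq_conjq rform_realq. Qed.

Lemma rformDm n (A B : 'M[quat R]_n) x y :
  rform (A + B) x y = rform A x y + rform B x y.
Proof. by rewrite unlock mulmxDr mulmxDl mxE. Qed.

Lemma rformNm n (A : 'M[quat R]_n) x y : rform (- A) x y = - rform A x y.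
Proof. by rewrite unlock mulmxN mulNmx mxE. Qed.

Lemma rform_realm n a (x y : 'cV[quat R]_n) :
  rform (realq a)%:M x y = a * rform 1%:M x y.
Proof.
rewrite -rform_realq unlock mulmx1 -mulmxA; congr (q0 ((_ *m _) _ _)).
apply/colP => i; rewrite rscaleE mul_scalar_mx [LHS]mxE; exact: realqC.
Qed.

Lemma rform1_entries n (x : 'cV[quat R]_n) :
  rform 1%:M x x = \sum_i sqnormq (x i 0).
Proof.
rewrite unlock mulmx1 mxE (big_morph (@q0 R) (id1 := 0) (op1 := +%R)) //.
apply: eq_bigr => i _.
by rewrite adjmxE q0_mulC mulq_conjq.
Qed.

Lemma rform_block n1 n2 (Aul : 'M[quat R]_n1) Aur Adl (Adr : 'M[quat R]_n2)
    x1 x2 y1 y2 :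
  rform (block_mx Aul Aur Adl Adr) (col_mx x1 x2) (col_mx y1 y2) =
  rform Aul x1 y1 + rform Adl x2 y1 + (rform Aur x1 y2 + rform Adr x2 y2).
Proof.
by rewrite unlock adjmx_col mul_row_block mul_row_col !mulmxDl !mxE.
Qed.

End RealForm.

(** * Recovering a selfadjoint matrix from a quadratic functional *)

Section JordanVonNeumann.
Variables (R : realFieldType) (n : nat) (phi : 'cV[quat R]_n -> R).
Implicit Types (x y z : 'cV[quat R]_n) (q : quat R) (a : R).
Hypothesis phi_parallelogram :
  forall x y, phi (x + y) + phi (x - y) = 2 * phi x + 2 * phi y.
Hypothesis phi_scale : forall x q, phi (x *> q) = sqnormq q * phi x.

Definition polar x y := (phi (x + y) - phi (x - y)) / 4.

Lemma phi0 : phi 0 = 0.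
Proof. by move: (phi_parallelogram 0 0); rewrite addr0 subr0; lra. Qed.

Lemma phiN x : phi (- x) = phi x.
Proof. by move: (phi_parallelogram 0 x); rewrite !add0r phi0; lra. Qed.

Lemma polarxx x : polar x x = phi x.
Proof.
by rewrite /polar subrr phi0; move: (phi_parallelogram x x); rewrite subrr phi0; lra.
Qed.

Lemma polarC x y : polar x y = polar y x.
Proof. by rewrite /polar [x + y]addrC -(phiN (x - y)) opprB. Qed.

Lemma polar0l y : polar 0 y = 0.
Proof. by rewrite /polar add0r sub0r phiN subrr mul0r. Qed.

(** The parallelogram law for the pairs [x + z, y + z] and [x - z, y - z]; the
    terms [phi (x - y)] cancel. *)
Lemma polar_double x y z : polar x z + polar y z = polar (x + y) (z *+ 2) / 2.
Proof.
have e1 := phi_parallelogram (x + z) (y + z).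
have e2 := phi_parallelogram (x - z) (y - z).
rewrite (_ : x + z + (y + z) = x + y + z *+ 2) in e1; last by rewrite addrACA.
rewrite (_ : x + z - (y + z) = x - y) in e1; last by rewrite opprD addrACA subrr addr0.
rewrite (_ : x - z + (y - z) = x + y - z *+ 2) in e2; last by rewrite addrACA -opprD.
rewrite (_ : x - z - (y - z) = x - y) in e2; last by rewrite opprB addrA subrK.
by rewrite /polar; lra.
Qed.

Lemma polarDl x y z : polar (x + y) z = polar x z + polar y z.
Proof.
have := polar_double (x + y) 0 z.
by rewrite polar0l !addr0 -polar_double.
Qed.

Lemma polarDr x y z : polar x (y + z) = polar x y + polar x z.
Proof. by rewrite polarC polarDl !(polarC _ x). Qed.

Lemma polar_scale x y q : polar (x *> q) (y *> q) = sqnormq q * polar x y.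
Proof. by rewrite /polar -rscaleDl -rscaleBl !phi_scale; ring. Qed.

Lemma polarNr x y : polar x (- y) = - polar x y.
Proof. by rewrite /polar opprK; ring. Qed.

(** Over the reals alone this may fail, since [polar] need not be continuous:
    a derivation of the field of reals gives a counterexample. Here the scalar
    [1 + a i], of squared modulus [1 + a ^+ 2], forces the identity. *)
Lemma polar_real_swap x y a : polar (x *> realq a) y = polar x (y *> realq a).
Proof.
have [i [ii i1 ni]] : exists i : quat R, [/\ i * i = -1, sqnormq i = 1 &
    forall b, sqnormq (1 + i * realq b) = 1 + sqnormq (i * realq b)].
  exists (Quat 0 1 0 0); split; first by congr Quat; rewrite /=; ring.
    by rewrite /sqnormq /=; ring.
  by move=> b; rewrite /sqnormq /=; ring.
have swap_i u v : polar (u *> i) v = - polar u (v *> i).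
  rewrite -{1}(rscale1 v) (_ : 1 = - i * i); last by rewrite mulNr ii opprK.
  rewrite -rscaleA polar_scale i1 mul1r -polarNr; congr polar.
  exact: rscaleNr.
(* Expanding [polar (x (1 + i a)) (z (1 + i a))] leaves the two cross terms,
   whose sum therefore vanishes. *)
have swap z : polar x (z *> i *> realq a) = polar (x *> realq a) (z *> i).
  have e1 := polar_scale x z (1 + i * realq a).
  rewrite ni !rscaleDr !rscale1 polarDl !polarDr polar_scale in e1.
  rewrite rscaleA -[RHS]opprK -swap_i rscaleA realqC.
  move: e1; move: (i * realq a) => q.
  move: (polar x z) (polar x _) (polar _ z) (sqnormq _) => b1 b2 b3 s.
  by lra.
have := swap (y *> - i); rewrite !rscaleA mulrA mulNr ii opprK.
by rewrite mul1r rscale1.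
Qed.

(** Comparing the scalars [a] and [1 + a] gives the value [2 a (polar x y)] for
    the sum of the two cross terms, which are equal by [polar_real_swap]. *)
Lemma polar_realq x y a : polar x (y *> realq a) = a * polar x y.
Proof.
have e1 := polar_scale x y (realq a).
have e2 := polar_scale x y (realq (1 + a)).
have e3 := polar_real_swap x y a.
have r1 u : u *> realq (1 + a) = u + u *> realq a :> 'cV[quat R]_n.
  rewrite -{2}(rscale1 u) -rscaleDr.
  by congr (_ *> _); congr Quat; rewrite /= addr0.
rewrite !r1 !sqnormq_realq polarDl !polarDr e1 e3 sqnormq_realq in e2.
move: e2; move: (polar x y) (polar x _) => b1 b2.
by nra.
Qed.

(** Write [y] as [(y q^-1) q] and use [|q|^2 q^-1 = q^*]. *)
Lemma polar_scalel x y q : polar (x *> q) y = polar x (y *> conjq q).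
Proof.
have [->|qn0] := eqVneq q 0.
  by rewrite rscale0r polar0l (conjq_realq 0) rscale0r polarC polar0l.
have nq : sqnormq q != 0 by rewrite sqnormq_eq0.
rewrite -{1}(rscale1 y) -(mulVq qn0) -rscaleA polar_scale -rscaleA polar_realq.
by rewrite mulrA divff // mul1r.
Qed.

Lemma polar_sumr x (I : Type) (r : seq I) (f : I -> 'cV[quat R]_n) :
  polar x (\sum_(i <- r) f i) = \sum_(i <- r) polar x (f i).
Proof.
by apply: big_morph; [exact: polarDr | rewrite polarC polar0l].
Qed.

Lemma polar_suml y (I : Type) (r : seq I) (f : I -> 'cV[quat R]_n) :
  polar (\sum_(i <- r) f i) y = \sum_(i <- r) polar (f i) y.
Proof. by rewrite polarC polar_sumr; apply: eq_bigr => i _; rewrite polarC. Qed.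

(** The quaternion representing the real functional [q |-> polar x (y q)] for
    the pairing [q0 (_ * _)]. *)
Definition polarq x y := Quat (polar x y) (- polar x (y *> Quat 0 1 0 0))
  (- polar x (y *> Quat 0 0 1 0)) (- polar x (y *> Quat 0 0 0 1)).

Lemma polarqE x y q : q0 (polarq x y * q) = polar x (y *> q).
Proof.
case: q => a b c d; rewrite /polarq.
have -> : y *> Quat a b c d = y *> realq a + y *> Quat 0 1 0 0 *> realq b
    + y *> Quat 0 0 1 0 *> realq c + y *> Quat 0 0 0 1 *> realq d.
  rewrite (rscaleA y _ (realq b)) (rscaleA y _ (realq c)) (rscaleA y _ (realq d)).
  rewrite -!(rscaleDr y); congr rscale; congr Quat; rewrite /=; ring.
move: (y *> Quat 0 1 0 0) (y *> Quat 0 0 1 0) (y *> Quat 0 0 0 1) => y1 y2 y3.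
do 3 rewrite (polarDr x).
rewrite (polar_realq x y) (polar_realq x y1) (polar_realq x y2).
rewrite (polar_realq x y3).
move: (polar x y) (polar x y1) (polar x y2) (polar x y3) => b0 b1 b2 b3.
by rewrite /=; ring.
Qed.

(** The entries are the quaternions representing [polar] on the canonical basis.
    The parallelogram law makes [polar] additive, and homogeneity for
    quaternionic scalars takes the place of the continuity which the real
    Jordan-von Neumann theorem requires. *)
Lemma selfadjoint_of_quadratic :
  exists2 H : 'M[quat R]_n, H^H = H & forall x, rform H x x = phi x.
Proof.
pose e i : 'cV[quat R]_n := delta_mx i 0.
exists (\matrix_(i, j) polarq (e i) (e j)).
  apply/matrixP => i j; rewrite adjmxE !mxE; apply: q0_mul_inj => s.
  rewrite q0_conjqM (polarqE _ _ s) (polarqE _ _ (conjq s)).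
  by rewrite polarC polar_scalel conjqK.
move=> x; rewrite -polarxx.
have xE : x = \sum_i e i *> x i 0.
  apply/colP => k; rewrite summxE (bigD1 k) //= big1 ?addr0.
    by rewrite rscaleE !mxE !eqxx mul1r.
  by move=> i /negbTE ik; rewrite rscaleE !mxE eq_sym ik mul0r.
rewrite [in RHS]xE polar_suml unlock -mulmxA mxE.
rewrite (big_morph (@q0 R) (id1 := 0) (op1 := +%R)) //; apply: eq_bigr => i _.
rewrite polar_sumr [X in _ * X]mxE mulr_sumr.
rewrite (big_morph (@q0 R) (id1 := 0) (op1 := +%R)) //; apply: eq_bigr => j _.
by rewrite q0_mulC [X in X * _ * _]mxE -mulrA polarqE polar_scalel rscaleA adjmxE.
Qed.

End JordanVonNeumann.

(** * Positivity of the tridiagonal Toeplitz form *)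

Section RootsOfUnity.
Variable R : realType.
Implicit Types (a b : R).

(** The exponential of [a i]. *)
Definition qexp a : quat R := Quat (cos a) (sin a) 0 0.

Lemma qexp0 : qexp 0 = 1.
Proof. by rewrite /qexp cos0 sin0. Qed.

Lemma qexpD a b : qexp (a + b) = qexp a * qexp b.
Proof. by congr Quat; rewrite /= ?cosD ?sinD; ring. Qed.

Lemma conjq_qexp a : conjq (qexp a) = qexp (- a).
Proof. by rewrite /qexp /conjq /= cosN sinN oppr0. Qed.

Lemma sqnormq_qexp a : sqnormq (qexp a) = 1.
Proof. by rewrite /sqnormq /= expr0n /= !addr0 cos2Dsin2. Qed.

Lemma qexp_natM a m : qexp (m%:R * a) = qexp a ^+ m.
Proof.
elim: m => [|m IH]; first by rewrite mul0r qexp0 expr0.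
by rewrite exprS -IH -qexpD -[in LHS]add1n natrD mulrDl mul1r.
Qed.

Lemma qexp_2pi : qexp (2 * pi) = 1.
Proof. by rewrite /qexp mulr_natl cos2pi sin2pi. Qed.

(** The angle is twice some [h] strictly between [0] and [pi], and
    [cos (2 h) = 1 - 2 (sin h) ^+ 2]. *)
Lemma qexp_root_neq1 (M p q : nat) : (q < p < M)%N ->
  qexp ((p%:R - q%:R) * (2 * pi / M%:R)) != 1.
Proof.
move=> /andP[qp pM]; apply/eqP => /(congr1 (@q0 R)) /=.
have M0 : 0 < M%:R :> R by rewrite ltr0n (leq_trans _ pM).
pose h : R := (p - q)%:R * pi / M%:R.
have -> : (p%:R - q%:R) * (2 * pi / M%:R) = h *+ 2 :> R.
  by rewrite /h natrB ?(ltnW qp) //; field; rewrite gt_eqF.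
have : 0 < sin h.
  apply: sin_gt0_pi; rewrite /h; apply/andP; split.
    by rewrite divr_gt0 // mulr_gt0 ?pi_gt0 // ltr0n subn_gt0.
  rewrite ltr_pdivrMr // mulrC ltr_pM2l ?pi_gt0 // ltr_nat.
  by rewrite (leq_ltn_trans (leq_subr _ _)).
by rewrite mulr2n cosD; move: (cos2Dsin2 h) => ? ? ?; nra.
Qed.

(** Orthogonality of the characters of the cyclic group of order [M]. *)
Lemma sum_roots_of_unity (M p q : nat) : (p < M)%N -> (q < M)%N ->
  \sum_(m < M) qexp (m%:R * ((p%:R - q%:R) * (2 * pi / M%:R))) =
  if p == q then realq M%:R else 0.
Proof.
move=> pM qM; case: eqP => [->|/eqP pq].
  under eq_bigr do rewrite subrr mul0r mulr0 qexp0.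
  rewrite sumr_const card_ord.
  by elim: M {pM qM} => // M IH; rewrite mulrS IH; congr Quat; rewrite /= ?addr0 // mulrS.
have M0 : M%:R != 0 :> R by rewrite pnatr_eq0 -lt0n (leq_trans _ pM).
set w := (p%:R - q%:R) * _.
under eq_bigr do rewrite qexp_natM.
have w1 : qexp w - 1 != 0.
  rewrite subr_eq0 /w; move: pq; rewrite neq_ltn => /orP[pq|qp]; last first.
    by apply: qexp_root_neq1; rewrite qp.
  have := qexp_root_neq1 (_ : (p < q < M)%N); rewrite pq qM => /(_ isT).
  apply: contra => /eqP /(congr1 (@conjq R)); rewrite conjq_qexp -mulNr opprB => ->.
  by rewrite (conjq_realq 1).
rewrite -[LHS]mul1r -(mulVq w1) -mulrA -subrX1 -qexp_natM.
have -> : M%:R * w = p%:R * (2 * pi) + - (q%:R * (2 * pi)).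
  by rewrite /w; field.
rewrite qexpD -conjq_qexp !(qexp_natM (2 * pi)) qexp_2pi !expr1n (conjq_realq 1).
by rewrite mulr1 subrr mulr0.
Qed.

End RootsOfUnity.

Section NumericalRadiusBound.
Variables (R : realType) (n : nat) (A : 'M[quat R]_n).
Hypothesis n_gt0 : (0 < n)%N.
Implicit Types (x : 'cV[quat R]_n) (q : quat R).

Lemma gram_realq x : (x^H *m x) 0 0 = realq (rform 1%:M x x).
Proof.
by rewrite unlock mulmx1; apply: conjq_fixed; rewrite -adjmxE adjmxM adjmxK.
Qed.

Lemma rform1_ge0 x : 0 <= rform 1%:M x x.
Proof. by rewrite rform1_entries sumr_ge0 // => i _; exact: sqnormq_ge0. Qed.

Lemma rform1_eq0 x : rform 1%:M x x = 0 -> x = 0.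
Proof.
rewrite rform1_entries => /psumr_eq0P x0; apply/colP => i; rewrite [RHS]mxE.
apply/eqP; rewrite -sqnormq_eq0 x0 // => j _; exact: sqnormq_ge0.
Qed.

Lemma qf_scale x q : ((x *> q)^H *m A *m (x *> q)) 0 0 =
  conjq q * (x^H *m A *m x) 0 0 * q.
Proof.
rewrite unlock adjmxM adjmx_scalar -!mulmxA mul_scalar_mx [LHS]mxE -mulrA.
congr (_ * _); rewrite !mulmxA [LHS]mxE big_ord1 [X in _ * X]mxE.
by rewrite eqxx mulr1n.
Qed.

(** The definition of the numerical radius, freed by homogeneity from the
    normalization of [x]. *)
Lemma numerical_radius_ge x :
  normq ((x^H *m A *m x) 0 0) <= numerical_radius A * rform 1%:M x x.
Proof.
have [_ ub] := numerical_radius_max A n_gt0.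
have [x0|xn0] := eqVneq (rform 1%:M x x) 0.
  by rewrite x0 (rform1_eq0 x0) !mulmx0 mulr0 mxE (normq_realq (lexx 0)).
have nx : 0 < rform 1%:M x x by rewrite lt_def xn0 rform1_ge0.
set c := rform 1%:M x x in nx *.
pose s := realq (Num.sqrt c)^-1.
have s0 : 0 <= (Num.sqrt c)^-1 by rewrite invr_ge0 sqrtr_ge0.
have ss : sqnormq s = c^-1.
  by rewrite -sqr_normq normq_realq // exprVn sqr_sqrtr // ltW.
have : normq (((x *> s)^H *m A *m (x *> s)) 0 0) <= numerical_radius A.
  apply: ub; exists (x *> s) => //=.
  apply/matrixP => i j; rewrite !ord1 gram_realq rform_scale ss -/c mulVf //.
  by rewrite mxE eqxx.
rewrite qf_scale conjq_realq !normqM (normq_realq s0).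
rewrite mulrAC -expr2 exprVn sqr_sqrtr ?(ltW nx) // mulrC ler_pdivrMr //.
Qed.

(** The last term is the real part of [(x^* A x) q], a quaternion of the same
    modulus as [x^* A x]. *)
Lemma rform_unit_ge x q : sqnormq q = 1 ->
  0 <= numerical_radius A * rform 1%:M x x + rform A x (x *> q).
Proof.
move=> q1; rewrite rform_scalerE -lerBlDl sub0r.
apply: le_trans (q0_ge_Nnormq _); rewrite lerN2 normqM (normqE q).
by rewrite q1 sqrtr1 mulr1; exact: numerical_radius_ge.
Qed.

End NumericalRadiusBound.

Section ToeplitzForm.
Variables (R : realType) (n : nat).
Implicit Types (u v : nat -> 'cV[quat R]_n) (B : 'M[quat R]_n).

(** The values at the [N.+1]-st roots of unity of the trigonometric polynomial
    with coefficients [u], which multiply the exponentials from the left. *)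
Definition trig_poly (N : nat) u (m : nat) : 'cV[quat R]_n :=
  \sum_(k < N) u k *> qexp (m%:R * (k%:R * (2 * pi / N.+1%:R))).

(** Averaging over the [N.+1]-st roots of unity isolates one diagonal. The
    number of roots exceeds by one the number of coefficients because, for
    [s = 1], the frequencies [l - (k + s)] can reach [- N] and must not be
    congruent to [0] unless they vanish. *)
Lemma sum_trig_poly B N u s : (s <= 1)%N -> (forall k, (N <= k)%N -> u k = 0) ->
  \sum_(m < N.+1) rform B (trig_poly N u m)
     (trig_poly N u m *> qexp (- (m%:R * (s%:R * (2 * pi / N.+1%:R))))) =
  N.+1%:R * \sum_(k < N) rform B (u k) (u (k + s)%N).
Proof.
move=> s1 u0; set t := 2 * pi / _.
transitivity (\sum_(m < N.+1) \sum_(k < N) \sum_(l < N)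
    rform B (u k) (u l *> qexp (m%:R * ((l%:R - (k + s)%:R) * t)))).
  apply: eq_bigr => m _; rewrite rscale_suml rform_suml; apply: eq_bigr => k _.
  rewrite rform_sumr; apply: eq_bigr => l _.
  rewrite rform_scalel rscaleA rscaleA conjq_qexp -!qexpD -/t; congr (rform B _ (_ *> qexp _)).
  by rewrite natrD; ring.
rewrite exchange_big mulr_sumr; apply: eq_bigr => k _ /=.
rewrite exchange_big /=.
have kN : (k + s < N.+1)%N 
  by rewrite ltnS (leq_trans (leq_add (leqnn k) s1)) // addn1 ltn_ord.
under eq_bigr => l _.
  rewrite -rform_sumr -rscale_sumr sum_roots_of_unity //; last exact: leqW (ltn_ord l).
  over.
(* When [k + s] leaves the range of [l], no diagonal term is left, in accordance
   with [u (k + s) = 0]. *)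
have [ksN|ksN] := ltnP (k + s) N.
  rewrite (bigD1 (Ordinal ksN)) //= eqxx rform_realq big1 ?addr0 // => l lks.
  case: eqP => [e|_]; last by rewrite rscale0r rform0r.
  by move: lks; rewrite -val_eqE /= e eqxx.
rewrite (u0 _ ksN) rform0r mulr0 big1 // => l _.
case: eqP => [e|_]; last by rewrite rscale0r rform0r.
by have := ltn_ord l; rewrite e ltnNge ksN.
Qed.

End ToeplitzForm.

(** * The least energy of a continuation *)

Section Energy.
Variables (R : realType) (n : nat) (A : 'M[quat R]_n).
Hypothesis n_gt0 : (0 < n)%N.
Implicit Types (u v : nat -> 'cV[quat R]_n) (x y : 'cV[quat R]_n) (q : quat R).

(** The form of the block tridiagonal Toeplitz matrix with [r I] on the diagonal
    and halves of [A] and [A^*] beside it. *)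
Definition energy N u : R :=
  \sum_(k < N) (numerical_radius A * rform 1%:M (u k) (u k) +
                rform A (u k) (u k.+1)).

Definition vanish_from (N : nat) u := forall k, (N <= k)%N -> u k = 0.

(** The energy is the average over the roots of unity of the quantities that
    [rform_unit_ge] bounds from below. *)
Lemma energy_ge0 N u : vanish_from N u -> 0 <= energy N u.
Proof.
move=> u0; have N0 : 0 < N.+1%:R :> R by rewrite ltr0n.
rewrite -(pmulr_rge0 _ N0) /energy big_split -mulr_sumr mulrDr mulrCA /=.
have := sum_trig_poly 1%:M (leq0n 1) u0; have := sum_trig_poly A (leqnn 1) u0.
under [X in _ = _ * X]eq_bigr do rewrite addn1.
move=> <-; under [X in _ = _ * X]eq_bigr do rewrite addn0.
move=> <-; rewrite mulr_sumr -big_split /=; apply: sumr_ge0 => m _.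
rewrite mul0r mulr0 oppr0 qexp0 rscale1.
by apply: rform_unit_ge => //; exact: sqnormq_qexp.
Qed.

Lemma energy_widen N M u : (N <= M)%N -> vanish_from N u -> energy M u = energy N u.
Proof.
move=> /subnKC <-; elim: (M - N)%N => [|d IH] u0; first by rewrite addn0.
rewrite addnS {1}/energy big_ord_recr /= -/(energy _ _) IH //.
by rewrite (u0 _ (leq_addr _ _)) rform0l rform0l mulr0 !addr0.
Qed.

Lemma energy_parallelogram N u v :
  energy N (fun k => u k + v k) + energy N (fun k => u k - v k) =
  2 * energy N u + 2 * energy N v.
Proof.
rewrite /energy !mulr_sumr -!big_split /=; apply: eq_bigr => k _.
by rewrite !rformDl !rformDr !rformNl !rformNr; ring.
Qed.

Lemma energy_scale N u q : energy N (fun k => u k *> q) = sqnormq q * energy N u.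
Proof.
rewrite /energy mulr_sumr; apply: eq_bigr => k _.
by rewrite !rform_scale; ring.
Qed.

Definition shift x u (k : nat) := if k is k'.+1 then u k' else x.

Lemma energy_shift N x u :
  energy N.+1 (shift x u) =
  numerical_radius A * rform 1%:M x x + rform A x (u 0%N) + energy N u.
Proof. by rewrite /energy big_ord_recl. Qed.

Definition energies x : set R :=
  [set e | exists N u, [/\ vanish_from N u, u 0%N = x & e = energy N u]].

Definition least_energy x : R := inf (energies x).

Lemma energies_ge0 x : lbound (energies x) 0.
Proof. by move=> _ [N [u [u0 _ ->]]]; exact: energy_ge0. Qed.

Lemma energies_nonempty x : energies x !=set0.
Proof.
exists (energy 1 (shift x (fun=> 0))), 1%N, (shift x (fun=> 0)); split=> //.
by case.
Qed.

Lemma least_energy_ge0 x : 0 <= least_energy x.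
Proof. by apply: lb_le_inf; [exact: energies_nonempty | exact: energies_ge0]. Qed.

Lemma least_energy_le N u : vanish_from N u -> least_energy (u 0%N) <= energy N u.
Proof.
move=> u0; apply: ge_inf; first by exists 0; exact: energies_ge0.
by exists N, u.
Qed.

Lemma least_energy_ge x c :
  (forall N u, vanish_from N u -> u 0%N = x -> c <= energy N u) -> c <= least_energy x.
Proof.
move=> H; apply: lb_le_inf; first exact: energies_nonempty.
by move=> _ [N [u [u0 ux ->]]]; exact: H.
Qed.

Lemma least_energy_scale_le x q : least_energy (x *> q) <= sqnormq q * least_energy x.
Proof.
have [->|qn0] := eqVneq q 0.
  rewrite (sqnormq_realq 0) expr0n mul0r.
  have := @least_energy_le 0%N (fun=> 0).
  by rewrite rscale0r /energy big_ord0; apply.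
have q0 : 0 < sqnormq q by rewrite lt_def sqnormq_eq0 qn0 sqnormq_ge0.
rewrite mulrC -ler_pdivrMr //; apply: least_energy_ge => N u u0 <-.
rewrite ler_pdivrMr // mulrC -energy_scale.
apply: (@least_energy_le N (fun k => u k *> q)) => k Nk.
by rewrite u0 // rscale0l.
Qed.

(** For invertible [q] the reverse inequality follows by scaling back. *)
Lemma least_energy_scale x q : least_energy (x *> q) = sqnormq q * least_energy x.
Proof.
apply/eqP; rewrite eq_le least_energy_scale_le /=.
have [->|qn0] := eqVneq q 0.
  rewrite (sqnormq_realq 0) expr0n mul0r.
  exact: least_energy_ge0.
have q0 : 0 < sqnormq q by rewrite lt_def sqnormq_eq0 qn0 sqnormq_ge0.
have := least_energy_scale_le (x *> q) (invq q).
rewrite rscaleA (mulqV qn0) rscale1 -(ler_pM2l q0) mulrA -sqnormqM (mulqV qn0).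
by rewrite (sqnormq_realq 1) expr1n mul1r.
Qed.

(** Continuations [u] of [x] and [v] of [y] give continuations [u + v] and
    [u - v] of [x + y] and [x - y]. *)
Lemma least_energy_parallelogram_le x y :
  least_energy (x + y) + least_energy (x - y) <=
  2 * least_energy x + 2 * least_energy y.
Proof.
rewrite -mulrDr mulrC -ler_pdivrMr // -lerBlDr.
apply: least_energy_ge => N u u0 ux; rewrite lerBlDr -lerBlDl.
apply: least_energy_ge => M v v0 vy; rewrite lerBlDl ler_pdivrMr // mulrC mulrDr.
pose K := maxn N M.
have u0' k : (K <= k)%N -> u k = 0 by rewrite geq_max => /andP[/u0].
have v0' k : (K <= k)%N -> v k = 0 by rewrite geq_max => /andP[_ /v0].
rewrite -(energy_widen (leq_maxl N M) u0) -(energy_widen (leq_maxr N M) v0).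
rewrite -energy_parallelogram -ux -vy -/K; apply: lerD.
  apply: (@least_energy_le K (fun k => u k + v k)) => k Kk.
  by rewrite u0' // v0' // addr0.
apply: (@least_energy_le K (fun k => u k - v k)) => k Kk.
by rewrite u0' // v0' // subr0.
Qed.

(** The reverse inequality is the preceding one for [x + y] and [x - y], whose
    sum and difference are [2 x] and [2 y]. *)
Lemma least_energy_parallelogram x y :
  least_energy (x + y) + least_energy (x - y) =
  2 * least_energy x + 2 * least_energy y.
Proof.
apply/eqP; rewrite eq_le least_energy_parallelogram_le /=.
have := least_energy_parallelogram_le (x + y) (x - y).
have dbl z : z + z = z *> realq 2.
  rewrite -{1 2}(rscale1 z) -rscaleDr; congr (_ *> _).
  by congr Quat; rewrite /= ?addr0.
rewrite (_ : x + y + (x - y) = x *> realq 2); last first.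
  by rewrite addrACA subrr addr0 dbl.
rewrite (_ : x + y - (x - y) = y *> realq 2); last first.
  by rewrite opprB [x + y]addrC addrACA subrr addr0 dbl.
rewrite !least_energy_scale !sqnormq_realq; lra.
Qed.

(** Prepend [x] to the continuations of [y]. *)
Lemma least_energy_shift x y :
  0 <= numerical_radius A * rform 1%:M x x - least_energy x + rform A x y +
       least_energy y.
Proof.
rewrite -lerBlDl sub0r; apply: least_energy_ge => N u u0 uy.
have := @least_energy_le N.+1 (shift x u) _.
rewrite energy_shift uy => /(_ _)/wrap[].
  by case=> // k; exact: u0.
by lra.
Qed.

End Energy.

(** * The numerical radius as a minimum *)

Theorem theorem5p5 (R : realType) (n : nat) (n_gt0 : (0 < n)%N)
    (A : 'M[quat R]_n) :
  is_min
    [set a : R | exists Z : 'M[quat R]_n,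
       psdmx (block_mx ((realq a)%:M + Z) A
                       (A^H)            ((realq a)%:M - Z))]
    (numerical_radius A).
Proof.
split; last first.
  move=> a [Z [_ psd]].
  have [[x x1 <-] _] := numerical_radius_max A n_gt0.
  have [s s1 ps] := exists_unit_opposite ((x^H *m A *m x) 0 0).
  have [c c0 ec] := psd (col_mx x (x *> s)).
  have : 0 <= rform (block_mx ((realq a)%:M + Z) A A^H ((realq a)%:M - Z))
      (col_mx x (x *> s)) (col_mx x (x *> s)) by rewrite unlock ec.
  have nx : rform 1%:M x x = 1 by rewrite unlock mulmx1 x1 mxE eqxx.
  rewrite rform_block (rform_adj A) (rformDm _ Z) (rformDm _ (- Z)) (rformNm Z).
  rewrite (rform_scale _ x x s) (rform_scale Z x x s) s1.
  rewrite (rform_realm a x x) nx (rform_scalerE A) ps.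
  by lra.
have [H HH HE] := selfadjoint_of_quadratic (least_energy_parallelogram A n_gt0)
  (least_energy_scale A n_gt0).
have [Z ZZ ZE] : exists2 Z : 'M[quat R]_n, Z^H = Z & forall v, rform Z v v =
    numerical_radius A * rform 1%:M v v - 2 * least_energy A v.
  exists ((realq (numerical_radius A))%:M - (H + H)).
    by rewrite adjmxD adjmxN adjmxD HH adjmx_scalar conjq_realq.
  by move=> v; rewrite (rformDm _ (- _)) rformNm (rformDm H) !HE rform_realm; ring.
exists Z; set M := block_mx _ _ _ _.
have MM : M^H = M.
  by rewrite /M adjmx_block !adjmxD adjmxN ZZ adjmxK adjmx_scalar conjq_realq.
split=> // w; exists (rform M w w); last first.
  rewrite unlock; apply: conjq_fixed.
  by rewrite -adjmxE !adjmxM adjmxK MM mulmxA.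
rewrite -(vsubmxK w) /M rform_block (rform_adj A).
move: (usubmx w) (dsubmx w) => x y.
rewrite (rformDm _ Z).
rewrite (rformDm _ (- Z)).
rewrite (rformNm Z).
rewrite (ZE x) (ZE y).
rewrite (rform_realm _ x x).
rewrite (rform_realm _ y y).
have := least_energy_shift A n_gt0 x y; lra.
Qed.
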